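(* Let $q,n\ge 1$ and let $f_n(z)=A_0z^n+A_1z^{n-1}+\cdots+A_n$ with $A_k\in\mathbb{C}^{q\times q}$ and $\det A_0\neq 0$ be a Hurwitz-type matrix polynomial (HTM polynomial), with parts $h_n,g_n$ and Markov parameters $(s_j)_{j\ge0}$. With the notation of the context, let $$\mathcal F_n(x,y)=\frac{f_n^*(\bar x)f_n(-y)-f_n^*(-\bar x)f_n(y)}{x-y}$$ and, for $k=0,1$, $$\mathcal W_{2m}^{(k)}=\begin{pmatrix}S(h_{2m}^* )&0\\ 0&S(h_{2m}^* )\end{pmatrix}\mathcal J_{m-1}^{(m-1)}\begin{pmatrix}H_{2,m-1}&0\\ 0&(-1)^kH_{1,m-1}\end{pmatrix}\mathcal J_{m-1}^{(m-1)}\begin{pmatrix}S(h_{2m})&0\\ 0&S(h_{2m})\end{pmatrix},$$ $$\mathcal W_{2m+1}^{(k)}=\begin{pmatrix}S(g_{2m+1}^* )&0\\ 0&S(\widetilde g_{2m+1}^* )\end{pmatrix}\mathcal J_{m-1}^{(m)}\begin{pmatrix}H_{1,m}&0\\ 0&(-1)^kH_{2,m-1}\end{pmatrix}\mathcal J_{m-1}^{(m)}\begin{pmatrix}S(g_{2m+1})&0\\ 0&S(\widetilde g_{2m+1})\end{pmatrix}.$$ Then, as polynomials in $x,y$: if $n=2m$ with $m\ge1$, $$\mathcal F_{2m}(x,y)=2\begin{pmatrix}F_0^{(2m-2)}(\bar x)\\ F_1^{(2m-1)}(\bar x)\end{pmatrix}^{*}\mathcal W_{2m}^{(1)}\begin{pmatrix}F_0^{(2m-2)}(y)\\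 F_1^{(2m-1)}(y)\end{pmatrix},$$ and if $n=2m+1$ with $m\ge1$, $$\mathcal F_{2m+1}(x,y)=2\begin{pmatrix}F_0^{(2m)}(\bar x)\\ F_1^{(2m-1)}(\bar x)\end{pmatrix}^{*}\mathcal W_{2m+1}^{(1)}\begin{pmatrix}F_0^{(2m)}(y)\\ F_1^{(2m-1)}(y)\end{pmatrix}.$$
   Context: All matrix coefficients are in $\mathbb{C}^{q\times q}$; $^*$ is the conjugate transpose, $I_q$ the identity. $f_n^*(\bar x)$ means $(f_n(\bar x))^*=\sum_kA_k^*x^{n-k}$ and $f_n^*(-\bar x)$ means $(f_n(-\bar x))^*$, both polynomials in $x$. Parts. For $f_n(z)=\sum_{k=0}^nA_kz^{n-k}$, $\det A_0\ne0$, the matrix polynomials $h_n,g_n$ are determined by $f_n(z)=h_n(z^2)+z\,g_n(z^2)$. Thus, for $n=2m$, $h_n(z)=A_0z^m+A_2z^{m-1}+\cdots+A_{2m}$ and $g_n(z)=A_1z^{m-1}+A_3z^{m-2}+\cdots+A_{2m-1}$; for $n=2m+1$, $h_n(z)=A_1z^m+A_3z^{m-1}+\cdots+A_{2m+1}$ and $g_n(z)=A_0z^m+A_2z^{m-1}+\cdots+A_{2m}$. HTM polynomial. For $n=2m$ ($m\ge1$), $f_n$ is an HTM polynomial if there are positive definite $q\times q$ matrices $c_0,\dots,c_{m-1},d_0,\dots,d_{m-1}$ such that $g_n(z)h_n(z)^{-1}=\Psi_0(z)$ as rational matrix functions, where $\Psi_{m-1}(z)=(zc_{m-1}+d_{m-1}^{-1})^{-1}$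 and $\Psi_k(z)=\big(zc_k+(d_k+\Psi_{k+1}(z))^{-1}\big)^{-1}$ for $0\le k\le m-2$. For $n=2m+1$, $f_n$ is an HTM polynomial if there are positive definite $c_0,\dots,c_m,d_0,\dots,d_{m-1}$ such that $h_n(z)(z g_n(z))^{-1}=\Phi_0(z)$ as rational matrix functions, where $\Phi_m(z)=z^{-1}c_m^{-1}$ and $\Phi_k(z)=\big(zc_k+(d_k+\Phi_{k+1}(z))^{-1}\big)^{-1}$ for $0\le k\le m-1$. Markov parameters. $(s_j)_{j\ge0}$ are the $q\times q$ matrices in the Laurent expansion at infinity $\sum_{j\ge0}(-1)^js_jz^{-j-1}$ of $g_n(z)h_n(z)^{-1}$ if $n=2m$, and of $h_n(z)(zg_n(z))^{-1}$ if $n=2m+1$. Put $H_{1,j}=(s_{a+b})_{a,b=0}^{j}$ and $H_{2,j}=(s_{a+b+1})_{a,b=0}^{j}$. Other notation. $\widetilde J_j=\mathrm{diag}(I_q,-I_q,I_q,\dots,(-1)^jI_q)$ is of size $(j+1)q$, and $\mathcal J_r^{(\ell)}=\mathrm{diag}(\widetilde J_\ell,\widetilde J_r)$. $F_0^{(2k)}(x)$ is the block column with blocks $I_q,x^2I_q,\dots,x^{2k}I_q$; $F_1^{(2k-1)}(x)$ is the block column with blocks $xI_q,x^3I_q,\dots,x^{2k-1}I_q$. $\widetilde g_{2m+1}(z)=A_0z^{m-1}+A_2z^{m-2}+\cdots+A_{2m-2}$. Symmetrizers. $S(h_{2m})$ is the $m\times m$ block Hankel matrix whose $(i,j)$ block,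 $1\le i,j\le m$, is the coefficient of $z^{i+j-1}$ in $h_{2m}(z)$ (first block row $A_{2m-2},\dots,A_2,A_0$). $S(g_{2m+1})$ is the $(m+1)\times(m+1)$ block Hankel matrix whose $(i,j)$ block, $0\le i,j\le m$, is the coefficient of $z^{i+j}$ in $g_{2m+1}(z)$ (first block row $A_{2m},\dots,A_2,A_0$). $S(\widetilde g_{2m+1})$ is the $m\times m$ block Hankel matrix whose $(i,j)$ block, $0\le i,j\le m-1$, is the coefficient of $z^{i+j}$ in $\widetilde g_{2m+1}(z)$ (first block row $A_{2m-2},\dots,A_2,A_0$). Blocks of missing coefficients are zero. $S(h_{2m}^* )$, $S(g_{2m+1}^* )$, $S(\widetilde g_{2m+1}^* )$ are the same matrices with each coefficient $A_k$ replaced by $A_k^*$. *)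

(* Defs.v *)
From HB Require Import structures.
From mathcomp Require Import all_boot all_order all_algebra.
From mathcomp Require Import reals.
From mathcomp Require Export complex.

Set Implicit Arguments.
Unset Strict Implicit.
Unset Printing Implicit Defensive.
Import Order.TTheory GRing.Theory Num.Theory.
Local Open Scope ring_scope.
Local Open Scope sesquilinear_scope.

(* Matrix polynomials in one variable z are matrices over {poly C}, rational
   matrix functions are matrices over the fraction field of {poly C}, and
   matrix polynomials in x, y are matrices over {poly {poly C}}, with x the
   outer variable 'X and y the inner variable 'X%:P (the convention of
   polyXY).  The theorem takes C := R[i], R : realType. *)

Notation ratfun C := {fraction {poly C}}.
Notation ratfun2 C := {fraction {poly {poly C}}}.

Section Definitions.
Variable C : numClosedFieldType.

Section PolynomialMatrices.
Variables a b : nat.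

Definition cst_pmx (M : 'M[C]_(a, b)) : 'M[{poly C}]_(a, b) := map_mx polyC M.

Definition coef_pmx (P : 'M[{poly C}]_(a, b)) (l : nat) : 'M[C]_(a, b) :=
  map_mx (fun p : {poly C} => p`_l) P.

(* P(-z) *)
Definition neg_pmx (P : 'M[{poly C}]_(a, b)) : 'M[{poly C}]_(a, b) :=
  map_mx (fun p : {poly C} => p \Po (- 'X)) P.

(* (P(\bar z))^*, as a polynomial in z: every matrix coefficient of P is
   replaced by its conjugate transpose *)
Definition star_pmx (P : 'M[{poly C}]_(a, b)) : 'M[{poly C}]_(b, a) :=
  (map_mx (map_poly Num.conj) P)^T.

Definition ratmx (P : 'M[{poly C}]_(a, b)) : 'M[ratfun C]_(a, b) :=
  map_mx (@tofrac {poly C}) P.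

Definition cst_ratmx (M : 'M[C]_(a, b)) : 'M[ratfun C]_(a, b) :=
  ratmx (cst_pmx M).

(* P(x) and P(y) *)
Definition in_x (P : 'M[{poly C}]_(a, b)) : 'M[{poly {poly C}}]_(a, b) :=
  map_mx (map_poly polyC) P.

Definition in_y (P : 'M[{poly C}]_(a, b)) : 'M[{poly {poly C}}]_(a, b) :=
  map_mx polyC P.

Definition cst_pmx2 (M : 'M[C]_(a, b)) : 'M[{poly {poly C}}]_(a, b) :=
  in_y (cst_pmx M).

Definition ratmx2 (P : 'M[{poly {poly C}}]_(a, b)) : 'M[ratfun2 C]_(a, b) :=
  map_mx (@tofrac {poly {poly C}}) P.

End PolynomialMatrices.

Section HTM.
Variable q : nat.
Implicit Types (A c d s : nat -> 'M[C]_q) (f : 'M[{poly C}]_q).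

Definition posdefmx (M : 'M[C]_q) : Prop :=
  M \is hermsymmx /\
  forall v : 'cV[C]_q, v != 0 -> 0 < (v^t* *m M *m v) 0 0.

(* only A 0, ..., A n are used *)
Definition fpoly (n : nat) A : 'M[{poly C}]_q :=
  \sum_(k < n.+1) 'X^(n - k) *: cst_pmx (A k).

(* f(z) = h(z^2) + z g(z^2) *)
Definition hpart f : 'M[{poly C}]_q := map_mx (@even_poly C) f.
Definition gpart f : 'M[{poly C}]_q := map_mx (@odd_poly C) f.

(* A_0 z^(m-1) + A_2 z^(m-2) + ... + A_(2m-2) *)
Definition gtilde (m : nat) A : 'M[{poly C}]_q :=
  \sum_(k < m) 'X^(m.-1 - k) *: cst_pmx (A k.*2).

(* g h^-1 for even n, h (z g)^-1 for odd n; det A_0 != 0 makes the inverted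
   matrix a unit over the field of rational functions *)
Definition assoc_ratfun (n : nat) A : 'M[ratfun C]_q :=
  let h := hpart (fpoly n A) in let g := gpart (fpoly n A) in
  if odd n then ratmx h *m invmx (ratmx ('X *: g))
  else ratmx g *m invmx (ratmx h).

Definition zvar : ratfun C := tofrac ('X : {poly C}).

(* The continued fraction Y_k with j further levels:
   Y_i = (z c_i + (d_i + Y_(i+1))^-1)^-1 for k <= i < k + j,
   Y_(k+j) = last.  For positive definite c_i, d_i, every matrix inverted here
   and in Psi, Phi below is invertible. *)
Fixpoint cfrac c d (last : 'M[ratfun C]_q) (k j : nat) : 'M[ratfun C]_q :=
  if j is j'.+1 then
    invmx (zvar *: cst_ratmx (c k)
           + invmx (cst_ratmx (d k) + cfrac c d last k.+1 j'))
  else last.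

(* for k < m *)
Definition Psi (m : nat) c d (k : nat) : 'M[ratfun C]_q :=
  cfrac c d
    (invmx (zvar *: cst_ratmx (c m.-1) + invmx (cst_ratmx (d m.-1))))
    k (m.-1 - k).

(* for k <= m *)
Definition Phi (m : nat) c d (k : nat) : 'M[ratfun C]_q :=
  cfrac c d (zvar^-1 *: invmx (cst_ratmx (c m))) k (m - k).

Definition HTM (n : nat) A : Prop :=
  let m := n./2 in
  if odd n then
    exists c d : nat -> 'M[C]_q,
      [/\ forall k, (k <= m)%N -> posdefmx (c k),
          forall k, (k < m)%N -> posdefmx (d k)
        & assoc_ratfun n A = Phi m c d 0]
  else
    (0 < m)%N /\
    exists c d : nat -> 'M[C]_q,
      [/\ forall k, (k < m)%N -> posdefmx (c k),
          forall k, (k < m)%N -> posdefmx (d k)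
        & assoc_ratfun n A = Psi m c d 0].

Definition vanishes_at_infty (r : ratfun C) : Prop :=
  exists p d : {poly C},
    [/\ d != 0, (size p < size d)%N & r = tofrac p / tofrac d].

(* M(z) = \sum_(j >= 0) e_j z^(-j-1) at infinity: for every N, the remainder
   after the terms j < N is o(z^-N) *)
Definition laurent_at_infty (e : nat -> 'M[C]_q) (M : 'M[ratfun C]_q) : Prop :=
  forall (N : nat) (i l : 'I_q),
    vanishes_at_infty
      (zvar ^+ N *
       (M - \sum_(j < N) (zvar ^- j.+1) *: cst_ratmx (e j)) i l).

Definition markov_params (n : nat) A s : Prop :=
  laurent_at_infty (fun j => (-1) ^+ j *: s j) (assoc_ratfun n A).

(* In the block matrices below, N is the number of blocks, so that
   H1 s N = H_{1,N-1}, H2 s N = H_{2,N-1}, Jtilde N is \tilde J_{N-1},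
   calJ N N' is \mathcal J_{N'-1}^{(N-1)}, F0 N = F_0^{(2N-2)} and
   F1 N = F_1^{(2N-1)}. *)

Definition H1 s (N : nat) := \mxblock_(i < N, j < N) s (i + j)%N.
Definition H2 s (N : nat) := \mxblock_(i < N, j < N) s (i + j).+1.

Definition Jtilde (N : nat) : 'M[C]_(\sum_(i < N) q) :=
  \mxdiag_(i < N) ((-1) ^+ i)%:M.

Definition calJ (N N' : nat) := block_mx (Jtilde N) 0 0 (Jtilde N').

Definition F0 (N : nat) : 'M[{poly C}]_(\sum_(i < N) q, q) :=
  \mxcol_(i < N) ('X^(i.*2))%:M.
Definition F1 (N : nat) : 'M[{poly C}]_(\sum_(i < N) q, q) :=
  \mxcol_(i < N) ('X^(i.*2.+1))%:M.

(* With 0-based i, j: S(h_{2m}) is symm1 m h, S(g_{2m+1}) is symm0 m.+1 g and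
   S(\tilde g_{2m+1}) is symm0 m gtilde. *)
Definition symm0 (N : nat) (P : 'M[{poly C}]_q) :=
  \mxblock_(i < N, j < N) coef_pmx P (i + j).
Definition symm1 (N : nat) (P : 'M[{poly C}]_q) :=
  \mxblock_(i < N, j < N) coef_pmx P (i + j).+1.

Definition calF (n : nat) A : 'M[ratfun2 C]_q :=
  let f := fpoly n A in
  (tofrac ('X - 'X%:P : {poly {poly C}}))^-1 *:
    ratmx2 (in_x (star_pmx f) *m in_y (neg_pmx f)
            - in_x (star_pmx (neg_pmx f)) *m in_y f).

Definition W_even (m : nat) A s (k : nat) :=
  let h := hpart (fpoly m.*2 A) in
  block_mx (symm1 m (star_pmx h)) 0 0 (symm1 m (star_pmx h))
  *m calJ m m
  *m block_mx (H2 s m) 0 0 ((-1) ^+ k *: H1 s m)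
  *m calJ m m
  *m block_mx (symm1 m h) 0 0 (symm1 m h).

Definition W_odd (m : nat) A s (k : nat) :=
  let g := gpart (fpoly m.*2.+1 A) in
  let gt := gtilde m A in
  block_mx (symm0 m.+1 (star_pmx g)) 0 0 (symm0 m (star_pmx gt))
  *m calJ m.+1 m
  *m block_mx (H1 s m.+1) 0 0 ((-1) ^+ k *: H2 s m)
  *m calJ m.+1 m
  *m block_mx (symm0 m.+1 g) 0 0 (symm0 m gt).

End HTM.
End Definitions.

Arguments F0 C q N : clear implicits.
Arguments F1 C q N : clear implicits.

(* Main.v *)
From HB Require Import structures.
Require Import Defs.
From mathcomp Require Import all_boot all_order all_algebra reals.
From mathcomp Require Import ring zify.
Import GRing.Theory Num.Theory.
Local Open Scope ring_scope.
Local Open Scope sesquilinear_scope.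

Set Implicit Arguments.
Unset Strict Implicit.
Unset Printing Implicit Defensive.

(** Write X = x^2, Y = y^2 and P^* for star_pmx P.  Splitting f into its parts,
    the numerator of the Bezoutian becomes
      2 (x g^*(X) h(Y) - y h^*(X) g(Y)).
    Two matrices P and N with
      X P + N = h^*(X) g(Y)   and   Y P + N = g^*(X) h(Y)
    turn this into (x - y) * 2 (N - x y P), a purely algebraic fact
    ([parity_identity]).  The corollary says that block Hankel forms in the
    Markov parameters provide such P and N.

    Let M = r p^-1 be the rational function attached to f, so (p, r) = (h, g)
    for even n and (p, r) = (z g, h) for odd n, and let e_k = (-1)^k s_k be its
    Laurent coefficients.  Comparing coefficients in M p = r gives the
    orthogonality relations sum_b e_(b+k) p_b = 0 and the formula
    sum_b e_b U_(b+1) = r, where U_b is the quotient of p by z^b.  These are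
    finite statements: z^N r minus (the first N terms of z^N M) p is a
    polynomial of degree below deg p ([laurent_remainder]).  The continued
    fraction of an HTM polynomial is Hermitian, M^* = M
    ([star_assoc_ratfun]), hence p^* M = r^* and the mirror relations hold for
    p^* and its quotients T_a.

    Since T_a = X T_(a+1) + p^*_a, multiplication of
    sum_(a,b) T_(a+1) e_(a+b) U_(b+1) by X shifts the index a, the constant
    terms being killed by orthogonality ([hankel_form_shiftl]); the row a = 0
    of the result collapses to a multiple of r(Y).  The same happens with Y on
    the other side, and the two identities required of P and N follow.

    Finally, multiplying a symmetrizer by the column (I, x^2 I, x^4 I, ...)
    produces the column of quotients U_b(x^2) ([symm0_mul_F0]), so the
    quadratic forms in the matrices W are exactly these Hankel forms. *)

(** * Conjugation of rational functions and Hermitian continued fractions *)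

Section FractionMorphism.
Variables (R S : idomainType) (phi : {rmorphism R -> S}).
Hypothesis phi_inj : injective phi.
Local Notation "p %:F" := (@tofrac _ p) (at level 1).

(** Numerator and denominator of a chosen representative: an arbitrary but
    fixed pair, so that a morphism can be applied to both. *)
Definition fnum (x : {fraction R}) : R := \n_(repr x).
Definition fden (x : {fraction R}) : R := \d_(repr x).

Lemma fden_neq0 x : fden x != 0.
Proof. exact: denom_ratioP. Qed.

Lemma fnum_div_fden x : x = (fnum x)%:F / (fden x)%:F.
Proof.
have d0 := fden_neq0 x; apply: (canRL (mulfK _)); first by rewrite tofrac_eq0.
rewrite -{1}[x]reprK; unlock FracField.tofrac; rewrite -[LHS]FracField.pi_mul.
rewrite /FracField.mulf !numden_Ratio ?oner_neq0 // mulr1.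
apply/eqmodP; rewrite /= FracField.equivfE /=.
by rewrite !numden_Ratio ?mulr1 ?oner_neq0 // mulrC.
Qed.

(** Injectivity of the morphism keeps denominators nonzero, which makes the
    value independent of the representative ([map_frac_div]). *)
Definition map_frac (x : {fraction R}) : {fraction S} :=
  (phi (fnum x))%:F / (phi (fden x))%:F.

Lemma phi_neq0 r : r != 0 -> (phi r)%:F != 0.
Proof.
rewrite tofrac_eq0; apply: contra => /eqP.
by rewrite -(rmorph0 phi) => /phi_inj->.
Qed.

Lemma map_frac_div n d : d != 0 ->
  map_frac (n%:F / d%:F) = (phi n)%:F / (phi d)%:F.
Proof.
move=> d0; have e0 := fden_neq0 (n%:F / d%:F).
have := fnum_div_fden (n%:F / d%:F); rewrite /map_frac.
move/eqP; rewrite eqr_div ?tofrac_eq0 // -!tofracM tofrac_eq => /eqP E.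
by apply/eqP; rewrite eqr_div ?phi_neq0 // -!tofracM -!rmorphM E.
Qed.

Lemma map_frac_tofrac p : map_frac p%:F = (phi p)%:F.
Proof.
rewrite -[p%:F]divr1 -tofrac1 map_frac_div ?oner_neq0 //.
by rewrite rmorph1 tofrac1 !divr1.
Qed.

Lemma map_frac_is_zmod_morphism : zmod_morphism map_frac.
Proof.
move=> x y; rewrite [x]fnum_div_fden [y]fnum_div_fden.
have [d0 e0] := (fden_neq0 x, fden_neq0 y).
rewrite -mulNr addf_div ?tofrac_eq0 // -tofracN -!tofracM -tofracD.
rewrite !map_frac_div ?mulf_neq0 // -mulNr addf_div ?phi_neq0 //.
by rewrite rmorphD !rmorphM rmorphN /= tofracD !tofracM tofracN.
Qed.

Lemma map_frac_is_monoid_morphism : monoid_morphism map_frac.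
Proof.
split=> [|x y]; first by rewrite -tofrac1 map_frac_tofrac rmorph1 tofrac1.
rewrite [x]fnum_div_fden [y]fnum_div_fden.
have [d0 e0] := (fden_neq0 x, fden_neq0 y).
rewrite mulf_div -!tofracM !map_frac_div ?mulf_neq0 //.
by rewrite mulf_div !rmorphM.
Qed.

End FractionMorphism.

Section Conjugation.
Variable C : numClosedFieldType.

Definition conj_frac : ratfun C -> ratfun C :=
  map_frac (map_poly (@Num.conj C)).

Lemma conjp_inj : injective (map_poly (@Num.conj C)).
Proof. exact: map_inj_poly (fmorph_inj _) (rmorph0 _). Qed.

HB.instance Definition _ := GRing.isZmodMorphism.Build _ _ conj_frac
  (map_frac_is_zmod_morphism conjp_inj).
HB.instance Definition _ := GRing.isMonoidMorphism.Build _ _ conj_frac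
  (map_frac_is_monoid_morphism conjp_inj).

Lemma conj_tofrac p : conj_frac (tofrac p) = tofrac (map_poly Num.conj p).
Proof. exact: (map_frac_tofrac conjp_inj). Qed.

Lemma conj_zvar : conj_frac (zvar C) = zvar C.
Proof. by rewrite /zvar conj_tofrac map_polyX. Qed.

Definition star_ratmx q (M : 'M[ratfun C]_q) : 'M[ratfun C]_q :=
  (map_mx conj_frac M)^T.

Lemma star_ratmxD q (M N : 'M[ratfun C]_q) :
  star_ratmx (M + N) = star_ratmx M + star_ratmx N.
Proof. by rewrite /star_ratmx map_mxD linearD. Qed.

Lemma star_ratmxZ q a (M : 'M[ratfun C]_q) :
  star_ratmx (a *: M) = conj_frac a *: star_ratmx M.
Proof. by rewrite /star_ratmx map_mxZ linearZ. Qed.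

Lemma star_ratmxM q (M N : 'M[ratfun C]_q) :
  star_ratmx (M *m N) = star_ratmx N *m star_ratmx M.
Proof. by rewrite /star_ratmx map_mxM trmx_mul. Qed.

(** Both transposition and field morphisms commute with [invmx] even where it
    is not an inverse, so the levels of a continued fraction can be conjugated
    one at a time with no invertibility argument. *)
Lemma star_invmx q (M : 'M[ratfun C]_q) :
  star_ratmx (invmx M) = invmx (star_ratmx M).
Proof. by rewrite /star_ratmx map_invmx trmx_inv. Qed.

Lemma star_ratmx_ratmx q (P : 'M[{poly C}]_q) :
  star_ratmx (ratmx P) = ratmx (star_pmx P).
Proof. by apply/matrixP => i j; rewrite !mxE conj_tofrac. Qed.

Lemma star_cst_ratmx q (M : 'M[C]_q) : M \is hermsymmx ->
  star_ratmx (cst_ratmx M) = cst_ratmx M.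
Proof.
move/is_hermitianmxP => MH; rewrite star_ratmx_ratmx; congr ratmx.
apply/matrixP => i j; rewrite !mxE map_polyC {2}MH.
by rewrite expr0 scale1r !mxE.
Qed.

Lemma star_cfrac q (c d : nat -> 'M[C]_q) last k j :
    (forall i, (k <= i < k + j)%N -> c i \is hermsymmx) ->
    (forall i, (k <= i < k + j)%N -> d i \is hermsymmx) ->
    star_ratmx last = last ->
  star_ratmx (cfrac c d last k j) = cfrac c d last k j.
Proof.
move=> + + lastH; elim: j k => [|j IH] k //= cH dH.
rewrite star_invmx star_ratmxD star_ratmxZ conj_zvar star_invmx star_ratmxD.
have k_in : (k <= k < k + j.+1)%N by rewrite leqnn addnS ltnS leq_addr.
rewrite (star_cst_ratmx (cH _ k_in)) (star_cst_ratmx (dH _ k_in)).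
rewrite IH // => i /andP[ki ij].
- by apply: cH; rewrite (ltnW ki) addnS -addSn.
- by apply: dH; rewrite (ltnW ki) addnS -addSn.
Qed.

(** The HTM hypothesis enters the proof through this symmetry: sums and
    inverses of Hermitian functions are Hermitian, and z is self-conjugate. *)
Lemma star_assoc_ratfun q n (A : nat -> 'M[C]_q) : HTM n A ->
  star_ratmx (assoc_ratfun n A) = assoc_ratfun n A.
Proof.
rewrite /HTM; case: ifP => _ [].
  move=> c [d [cpos dpos ->]]; apply: star_cfrac.
  - by move=> i; rewrite add0n subn0 => /andP[_ im]; case: (cpos i (ltnW im)).
  - by move=> i; rewrite add0n subn0 => /andP[_ im]; case: (dpos i im).
  - rewrite star_ratmxZ fmorphV /= conj_zvar star_invmx.
    by have [cH _] := cpos _ (leqnn n./2); rewrite (star_cst_ratmx cH).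
move=> m_gt0 [c [d [cpos dpos ->]]].
have lt_m1 : (n./2.-1 < n./2)%N by rewrite prednK.
apply: star_cfrac.
- move=> i; rewrite add0n subn0 => /andP[_ im].
  by case: (cpos i (ltn_trans im lt_m1)).
- move=> i; rewrite add0n subn0 => /andP[_ im].
  by case: (dpos i (ltn_trans im lt_m1)).
- rewrite star_invmx star_ratmxD star_ratmxZ conj_zvar star_invmx.
  have [[cH _] [dH _]] := (cpos _ lt_m1, dpos _ lt_m1).
  by rewrite (star_cst_ratmx cH) (star_cst_ratmx dH).
Qed.

End Conjugation.

(** * Coefficients of matrix polynomials and expansions at infinity *)

Section Coefficients.
Variable C : numClosedFieldType.

Lemma coef_pmxP a b (P Q : 'M[{poly C}]_(a, b)) :
  (forall l, coef_pmx P l = coef_pmx Q l) -> P = Q.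
Proof.
move=> PQ; apply/matrixP => i j; apply/polyP => l.
by move/matrixP/(_ i j): (PQ l); rewrite !mxE.
Qed.

Lemma coef_pmxD a b (P Q : 'M[{poly C}]_(a, b)) l :
  coef_pmx (P + Q) l = coef_pmx P l + coef_pmx Q l.
Proof. by apply/matrixP => i j; rewrite !mxE coefD. Qed.

Lemma coef_pmxB a b (P Q : 'M[{poly C}]_(a, b)) l :
  coef_pmx (P - Q) l = coef_pmx P l - coef_pmx Q l.
Proof. by apply/matrixP => i j; rewrite !mxE coefB. Qed.

Lemma coef_pmx_sum a b N (P : 'I_N -> 'M[{poly C}]_(a, b)) l :
  coef_pmx (\sum_i P i) l = \sum_i coef_pmx (P i) l.
Proof.
apply/matrixP => i j; rewrite mxE !summxE coef_sum.
by apply: eq_bigr => k _; rewrite mxE.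
Qed.

Lemma coef_pmxXnZ a b n (P : 'M[{poly C}]_(a, b)) l :
  coef_pmx ('X^n *: P) l = if (l < n)%N then 0 else coef_pmx P (l - n).
Proof.
by apply/matrixP => i j; rewrite !mxE coefXnM; case: ifP; rewrite !mxE.
Qed.

Lemma coef_pmxXZ a b (P : 'M[{poly C}]_(a, b)) l :
  coef_pmx ('X *: P) l = if l is l'.+1 then coef_pmx P l' else 0.
Proof. by apply/matrixP => i j; case: l => [|l]; rewrite !mxE coefXM. Qed.

Lemma coef_pmx_cstM a b c (M : 'M[C]_(a, b)) (P : 'M[{poly C}]_(b, c)) l :
  coef_pmx (cst_pmx M *m P) l = M *m coef_pmx P l.
Proof.
apply/matrixP => i j; rewrite !mxE coef_sum; apply: eq_bigr => k _.
by rewrite !mxE coefCM.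
Qed.

Lemma coef_cst_pmx a b (M : 'M[C]_(a, b)) l :
  coef_pmx (cst_pmx M) l = if l == 0%N then M else 0.
Proof.
by apply/matrixP => i j; rewrite !mxE coefC; case: eqP; rewrite ?mxE.
Qed.

Lemma coef_star_pmx a b (P : 'M[{poly C}]_(a, b)) l :
  coef_pmx (star_pmx P) l = (coef_pmx P l)^t*.
Proof. by apply/matrixP => i j; rewrite !mxE coef_map. Qed.

(** The quotient of P by z^k.  These quotients are the Horner partial sums
    that make up the columns of the symmetrizers. *)
Definition tail_pmx a b (k : nat) (P : 'M[{poly C}]_(a, b)) :=
  map_mx (drop_poly k) P.

Lemma coef_tail_pmx a b k (P : 'M[{poly C}]_(a, b)) l :
  coef_pmx (tail_pmx k P) l = coef_pmx P (l + k).
Proof. by apply/matrixP => i j; rewrite !mxE coef_drop_poly. Qed.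

Lemma tail_pmx_recl a b k (P : 'M[{poly C}]_(a, b)) :
  tail_pmx k P = 'X *: tail_pmx k.+1 P + cst_pmx (coef_pmx P k).
Proof.
apply: coef_pmxP => l; rewrite coef_pmxD coef_pmxXZ coef_cst_pmx.
by case: l => [|l]; rewrite !coef_tail_pmx ?add0r // addr0 addnS.
Qed.

Lemma tail_pmx0 a b (P : 'M[{poly C}]_(a, b)) : tail_pmx 0 P = P.
Proof. by apply: coef_pmxP => l; rewrite coef_tail_pmx addn0. Qed.

Lemma tail_star_pmx a b k (P : 'M[{poly C}]_(a, b)) :
  tail_pmx k (star_pmx P) = star_pmx (tail_pmx k P).
Proof. by apply: coef_pmxP => l; rewrite !(coef_star_pmx, coef_tail_pmx). Qed.

End Coefficients.

Section Laurent.
Variable C : numClosedFieldType.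

(** Degree less than k for a rational function; k = 0 is vanishing at
    infinity.  Stated with an additive k so that it is stable under sums and
    can be compared with the size of a polynomial ([degree_lt_tofrac]). *)
Definition degree_lt (k : nat) (r : ratfun C) : Prop :=
  exists p d : {poly C},
    [/\ d != 0, (size p < size d + k)%N & r = tofrac p / tofrac d].

Lemma degree_ltD k r1 r2 :
  degree_lt k r1 -> degree_lt k r2 -> degree_lt k (r1 + r2).
Proof.
move=> [p1 [d1 [d1_0 pd1 ->]]] [p2 [d2 [d2_0 pd2 ->]]].
exists (p1 * d2 + p2 * d1), (d1 * d2); split; first by rewrite mulf_neq0.
  have [d1p d2p] : (0 < size d1)%N /\ (0 < size d2)%N by rewrite !size_poly_gt0.
  rewrite (leq_ltn_trans (size_polyD _ _)) // gtn_max (size_mul d1_0 d2_0).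
  apply/andP; split.
    apply: (leq_ltn_trans (size_polyMleq _ _)).
    by move: pd1 d1p d2p; case: (size d1) (size d2) => [|a] // [|b] //=; lia.
  apply: (leq_ltn_trans (size_polyMleq _ _)).
  by move: pd2 d1p d2p; case: (size d1) (size d2) => [|a] // [|b] //=; lia.
by rewrite addf_div ?tofrac_eq0 // !(tofracM, tofracD).
Qed.

Lemma degree_lt0 k : degree_lt k 0.
Proof.
exists 0, 1; rewrite oner_neq0 size_poly0 size_poly1 tofrac0 mul0r.
by split.
Qed.

Lemma degree_lt_sum k N (r : 'I_N -> ratfun C) :
  (forall i, degree_lt k (r i)) -> degree_lt k (\sum_i r i).
Proof.
by move=> rk; elim/big_ind: _ => //; [exact: degree_lt0 | exact: degree_ltD].
Qed.

Lemma degree_ltM k r (u : {poly C}) :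
    vanishes_at_infty r -> (size u <= k.+1)%N ->
  degree_lt k (r * tofrac u).
Proof.
move=> [p [d [d0 pd ->]]] uk; exists (p * u), d; split=> //.
  apply: (leq_ltn_trans (size_polyMleq _ _)).
  by move: pd uk; case: (size p) (size u) => [|a] [|b] /=; lia.
by rewrite mulrAC tofracM.
Qed.

Lemma degree_lt_tofrac k p : degree_lt k (tofrac p) -> (size p <= k)%N.
Proof.
move=> [a [d [d0 ad E]]].
have [->|p0] := eqVneq p 0; first by rewrite size_poly0.
move/(canLR (divfK _)): E; rewrite tofrac_eq0 => /(_ d0) /eqP.
rewrite -tofracM tofrac_eq => /eqP E; move: ad; rewrite -E size_mul //.
move: p0 d0; rewrite -!size_poly_gt0.
by case: (size p) (size d) => [|b] // [|c] //=; lia.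
Qed.

Variable q : nat.
Implicit Types (M : 'M[ratfun C]_q) (p r : 'M[{poly C}]_q) (e : nat -> 'M[C]_q).

(** Multiplying M p = r by z^N, the part of z^N M left after N terms vanishes
    at infinity, so its product with p has degree below d; being also a
    polynomial, it contributes nothing to the coefficients from d on.  The
    two lemmas that follow read off these coefficients. *)
Lemma laurent_remainder e M p r d N l :
    laurent_at_infty e M -> M *m ratmx p = ratmx r ->
    (forall i, (d < i)%N -> coef_pmx p i = 0) -> (d <= l)%N ->
  coef_pmx ('X^N *: r) l =
  \sum_(j < N) coef_pmx ('X^(N - j.+1) *: (cst_pmx (e j) *m p)) l.
Proof.
move=> eM Mp pd dl; apply/eqP; rewrite -subr_eq0 -coef_pmx_sum -coef_pmxB.
set D := (X in coef_pmx X l).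
suff DE : ratmx D = (zvar C ^+ N *: (M - \sum_(j < N) (zvar C ^- j.+1) *:
    cst_ratmx (e j))) *m ratmx p.
  apply/eqP/matrixP => i j; rewrite [LHS]mxE [RHS]mxE; apply: nth_default.
  apply: leq_trans dl; apply: degree_lt_tofrac.
  move/matrixP/(_ i j): DE; rewrite [in LHS]mxE => ->.
  rewrite [in X in degree_lt _ X]mxE; apply: degree_lt_sum => k.
  rewrite [ratmx p k j]mxE; apply: degree_ltM; first by rewrite mxE; exact: eM.
  apply/leq_sizeP => t dt; have /matrixP/(_ k j) := pd t dt.
  by rewrite !mxE.
rewrite -scalemxAl mulmxBl Mp scalerBr mulmx_suml scaler_sumr /D.
rewrite /ratmx map_mxB map_mxZ /= tofracXn -/(zvar C); congr (_ - _).
rewrite map_mx_sum; apply: eq_bigr => j _.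
rewrite map_mxZ /= tofracXn -/(zvar C) map_mxM -scalemxAl scalerA.
congr (_ *: _).
have z0 : zvar C != 0 by rewrite tofrac_eq0 polyX_eq0.
by rewrite expfB_cond // (negbTE z0) ltn_ord.
Qed.

(** Coefficients of z^l with l >= 0 in M p = r. *)
Lemma laurent_quotient e M p r d K :
    laurent_at_infty e M -> M *m ratmx p = ratmx r ->
    (forall i, (d < i)%N -> coef_pmx p i = 0) -> (d <= K)%N ->
  \sum_(b < K) cst_pmx (e b) *m tail_pmx b.+1 p = r.
Proof.
move=> eM Mp pd dK; apply: coef_pmxP => l; rewrite coef_pmx_sum.
have dKl : (d <= l + K)%N by rewrite (leq_trans dK) ?leq_addl.
have := laurent_remainder K eM Mp pd dKl.
rewrite coef_pmxXnZ ltnNge leq_addl addnK /= => ->; apply: eq_bigr => b _.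
rewrite coef_pmxXnZ !coef_pmx_cstM coef_tail_pmx.
have bK := ltn_ord b; case: ifP; first by lia.
by move=> _; congr (_ *m coef_pmx p _); lia.
Qed.

(** Coefficients of z^(-1-k) in M p = r. *)
Lemma laurent_orthogonal e M p r d k :
    laurent_at_infty e M -> M *m ratmx p = ratmx r ->
    (forall i, (d < i)%N -> coef_pmx p i = 0) ->
  \sum_(a < d.+1) e (a + k)%N *m coef_pmx p a = 0.
Proof.
move=> eM Mp pd.
(* with N = k + d + 1 the coefficient of degree d is that of z^(-1-k), and the
   terms j < k of the expansion do not reach it *)
have := laurent_remainder (k + d.+1) eM Mp pd (leqnn d).
rewrite coef_pmxXnZ ifT ?leq_addl // big_split_ord /=.
rewrite big1 => [|i _]; last first.
  by rewrite coef_pmxXnZ ifT //; have := ltn_ord i; lia.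
rewrite add0r => E; rewrite [RHS]E; apply: eq_bigr => i _.
rewrite coef_pmxXnZ coef_pmx_cstM.
have id := ltn_ord i; case: ifP; first by lia.
by move=> _; congr (e _ *m coef_pmx p _); lia.
Qed.

End Laurent.

(** * Hankel forms and the shift identities *)

Section HankelForms.
Variables (S : comNzRingType) (q : nat).
Implicit Types (T E U p : nat -> 'M[S]_q) (X Y : S).

Definition hankel_form m n T E U : 'M[S]_q :=
  \sum_(a < m) \sum_(b < n) T a *m E (a + b)%N *m U b.

Lemma tr_hankel_form m n T E U :
  (hankel_form m n T E U)^T =
  hankel_form n m (fun b => (U b)^T) (fun k => (E k)^T) (fun a => (T a)^T).
Proof.
rewrite /hankel_form exchange_big linear_sum /=; apply: eq_bigr => b _.
rewrite linear_sum /=; apply: eq_bigr => a _.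
by rewrite !trmx_mul mulmxA addnC.
Qed.

Lemma eq_hankel_form m n T1 T2 E1 E2 U1 U2 :
    (forall a, T1 a = T2 a) -> (forall k, E1 k = E2 k) ->
    (forall b, U1 b = U2 b) ->
  hankel_form m n T1 E1 U1 = hankel_form m n T2 E2 U2.
Proof.
move=> eT eE eU; apply: eq_bigr => a _; apply: eq_bigr => b _.
by rewrite eT eE eU.
Qed.

Lemma hankel_formN m n T E U :
  hankel_form m n T (fun k => - E k) U = - hankel_form m n T E U.
Proof.
rewrite /hankel_form -sumrN; apply: eq_bigr => a _.
by rewrite -sumrN; apply: eq_bigr => b _; rewrite mulmxN mulNmx.
Qed.

Lemma hankel_form_recl m n T E U :
  hankel_form m.+1 n T E U =
    T 0%N *m (\sum_(b < n) E b *m U b)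
    + hankel_form m n (fun a => T a.+1) (fun k => E k.+1) U.
Proof.
rewrite /hankel_form big_ord_recl mulmx_sumr; congr (_ + _).
by apply: eq_bigr => b _; rewrite mulmxA.
Qed.

Lemma hankel_form_recr m n T E U :
  hankel_form m n.+1 T E U =
    (\sum_(a < m) T a *m E a) *m U 0%N
    + hankel_form m n T (fun k => E k.+1) (fun b => U b.+1).
Proof.
apply: trmx_inj; rewrite linearD /= !tr_hankel_form hankel_form_recl.
rewrite trmx_mul; congr (_ *m _ + _); rewrite linear_sum /=.
by apply: eq_bigr => a _; rewrite trmx_mul.
Qed.

(** Multiplication by X undoes one step of T_a = X T_(a+1) + p_a; the
    corrections p_a are annihilated by the Hankel matrix. *)
Lemma hankel_form_shiftl d n T p E U X :
    (forall a, T a = X *: T a.+1 + p a) -> T d.+1 = 0 ->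
    (forall k, \sum_(a < d.+1) p a *m E (a + k)%N = 0) ->
  X *: hankel_form d n (fun a => T a.+1) E U = hankel_form d.+1 n T E U.
Proof.
move=> Trec Td orth; have -> : hankel_form d.+1 n T E U =
    X *: hankel_form d.+1 n (fun a => T a.+1) E U + hankel_form d.+1 n p E U.
  rewrite /hankel_form scaler_sumr -big_split; apply: eq_bigr => a _ /=.
  rewrite scaler_sumr -big_split; apply: eq_bigr => b _ /=.
  by rewrite {1}Trec !mulmxDl -!scalemxAl.
have -> : hankel_form d.+1 n p E U = 0.
  rewrite /hankel_form exchange_big big1 // => b _.
  by rewrite -mulmx_suml orth mul0mx.
rewrite addr0 /hankel_form big_ord_recr /= Td [X in _ + X]big1 ?addr0 // => b _.
by rewrite !mul0mx.
Qed.

(** The transpose of [hankel_form_shiftl]. *)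
Lemma hankel_form_shiftr d m T E p U Y :
    (forall b, U b = Y *: U b.+1 + p b) -> U d.+1 = 0 ->
    (forall k, \sum_(b < d.+1) E (b + k)%N *m p b = 0) ->
  Y *: hankel_form m d T E (fun b => U b.+1) = hankel_form m d.+1 T E U.
Proof.
move=> Urec Ud orth; apply: trmx_inj; rewrite linearZ /= !tr_hankel_form.
apply: (@hankel_form_shiftl _ _ (fun b => (U b)^T) (fun b => (p b)^T)).
- by move=> b; rewrite {1}Urec linearD linearZ.
- by rewrite Ud trmx0.
- move=> k; apply: trmx_inj; rewrite trmx0 -[RHS](orth k) linear_sum /=.
  by apply: eq_bigr => b _; rewrite trmx_mul !trmxK.
Qed.

(** The division of the Bezoutian numerator by x - y: both products on the
    left reduce to x Gx Hy - y Hx Gy, up to the factor 2, and substituting the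
    two hypotheses leaves a multiple of x - y. *)
Lemma parity_identity (x y : S) (Hx Gx Hy Gy P N : 'M[S]_q) :
    x ^+ 2 *: P + N = Hx *m Gy -> y ^+ 2 *: P + N = Gx *m Hy ->
  (Hx + x *: Gx) *m (Hy - y *: Gy) - (Hx - x *: Gx) *m (Hy + y *: Gy) =
  (x - y) *: (2%:R *: (N - (x * y) *: P)).
Proof.
rewrite !(mulmxBl, mulmxDl, mulmxBr, mulmxDr) -!(scalemxAl, scalemxAr).
move=> <- <-; apply/matrixP => i j.
move: (Hx *m Hy) (Gx *m Gy) => HH GG; rewrite !mxE; ring.
Qed.

End HankelForms.

(** * Evaluation at squares, symmetrizers and parity *)

Section Evaluation.
Variable C : numClosedFieldType.
Local Notation C2 := {poly {poly C}}.

Definition sq_pmx a b (P : 'M[{poly C}]_(a, b)) : 'M[{poly C}]_(a, b) :=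
  map_mx (comp_poly 'X^2) P.

Lemma in_xM a b c (P : 'M[{poly C}]_(a, b)) (Q : 'M_(b, c)) :
  in_x (P *m Q) = in_x P *m in_x Q.
Proof. exact: map_mxM. Qed.

Lemma in_yM a b c (P : 'M[{poly C}]_(a, b)) (Q : 'M_(b, c)) :
  in_y (P *m Q) = in_y P *m in_y Q.
Proof. exact: map_mxM. Qed.

Lemma in_xXZ a b (P : 'M[{poly C}]_(a, b)) : in_x ('X *: P) = 'X *: in_x P.
Proof. by rewrite /in_x map_mxZ /= map_polyX. Qed.

Lemma in_yXZ a b (P : 'M[{poly C}]_(a, b)) : in_y ('X *: P) = 'X%:P *: in_y P.
Proof. by rewrite /in_y map_mxZ. Qed.

Lemma in_x_cst a b (M : 'M[C]_(a, b)) : in_x (cst_pmx M) = cst_pmx2 M.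
Proof. by apply/matrixP => i j; rewrite !mxE map_polyC. Qed.

Lemma cst_pmx2M a b c (M : 'M[C]_(a, b)) (N : 'M_(b, c)) :
  cst_pmx2 (M *m N) = cst_pmx2 M *m cst_pmx2 N.
Proof. by rewrite /cst_pmx2 /in_y /cst_pmx !map_mxM. Qed.

Lemma sq_pmxD a b (P Q : 'M[{poly C}]_(a, b)) :
  sq_pmx (P + Q) = sq_pmx P + sq_pmx Q.
Proof. exact: map_mxD. Qed.

Lemma sq_pmxM a b c (P : 'M[{poly C}]_(a, b)) (Q : 'M_(b, c)) :
  sq_pmx (P *m Q) = sq_pmx P *m sq_pmx Q.
Proof. exact: map_mxM. Qed.

Lemma sq_pmx_sum a b N (P : 'I_N -> 'M[{poly C}]_(a, b)) :
  sq_pmx (\sum_i P i) = \sum_i sq_pmx (P i).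
Proof. exact: map_mx_sum. Qed.

Lemma in_x_sum a b N (P : 'I_N -> 'M[{poly C}]_(a, b)) :
  in_x (\sum_i P i) = \sum_i in_x (P i).
Proof. exact: map_mx_sum. Qed.

Lemma in_y_sum a b N (P : 'I_N -> 'M[{poly C}]_(a, b)) :
  in_y (\sum_i P i) = \sum_i in_y (P i).
Proof. exact: map_mx_sum. Qed.

Lemma cst_pmx2_sum a b N (M : 'I_N -> 'M[C]_(a, b)) :
  cst_pmx2 (\sum_i M i) = \sum_i cst_pmx2 (M i).
Proof. by rewrite /cst_pmx2 /cst_pmx map_mx_sum in_y_sum. Qed.

Lemma cst_pmx2_0 a b : cst_pmx2 (0 : 'M[C]_(a, b)) = 0.
Proof. by rewrite /cst_pmx2 /in_y /cst_pmx !map_mx0. Qed.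

Lemma sq_pmxXZ a b (P : 'M[{poly C}]_(a, b)) :
  sq_pmx ('X *: P) = 'X^2 *: sq_pmx P.
Proof. by rewrite /sq_pmx map_mxZ /= comp_polyX. Qed.

Lemma sq_cst_pmx a b (M : 'M[C]_(a, b)) : sq_pmx (cst_pmx M) = cst_pmx M.
Proof. by apply/matrixP => i j; rewrite !mxE comp_polyC. Qed.

Variable q : nat.
Implicit Types P Q : 'M[{poly C}]_q.

Definition x_tail P k : 'M[C2]_q := in_x (sq_pmx (tail_pmx k P)).
Definition y_tail P k : 'M[C2]_q := in_y (sq_pmx (tail_pmx k P)).

Lemma x_tail_recl P k :
  x_tail P k = 'X ^+ 2 *: x_tail P k.+1 + cst_pmx2 (coef_pmx P k).
Proof.
rewrite /x_tail tail_pmx_recl sq_pmxD sq_pmxXZ sq_cst_pmx -in_x_cst.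
by rewrite /in_x map_mxD map_mxZ /= map_polyXn.
Qed.

Lemma y_tail_recl P k :
  y_tail P k = 'X%:P ^+ 2 *: y_tail P k.+1 + cst_pmx2 (coef_pmx P k).
Proof.
rewrite /y_tail tail_pmx_recl sq_pmxD sq_pmxXZ sq_cst_pmx.
by rewrite /in_y map_mxD map_mxZ /= rmorphXn.
Qed.

Lemma tail_pmx_eq0 P k : (forall l, (k <= l)%N -> coef_pmx P l = 0) ->
  tail_pmx k P = 0.
Proof.
move=> Pk; apply: coef_pmxP => l; rewrite coef_tail_pmx Pk ?leq_addl //.
by apply/matrixP => i j; rewrite !mxE coef0.
Qed.

Lemma x_tail_eq0 P k : (forall l, (k <= l)%N -> coef_pmx P l = 0) ->
  x_tail P k = 0.
Proof. by move=> /tail_pmx_eq0 E; rewrite /x_tail E /in_x /sq_pmx !map_mx0. Qed.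

Lemma y_tail_eq0 P k : (forall l, (k <= l)%N -> coef_pmx P l = 0) ->
  y_tail P k = 0.
Proof. by move=> /tail_pmx_eq0 E; rewrite /y_tail E /in_y /sq_pmx !map_mx0. Qed.

Lemma pmx_coefE P N : (forall l, (N <= l)%N -> coef_pmx P l = 0) ->
  P = \sum_(k < N) 'X^k *: cst_pmx (coef_pmx P k).
Proof.
move=> PN; apply: coef_pmxP => l; rewrite coef_pmx_sum.
under eq_bigr => k _ do rewrite coef_pmxXnZ coef_cst_pmx.
case: (ltnP l N) => [lN|Nl].
  rewrite (bigD1 (Ordinal lN)) //= ltnn subnn eqxx big1 ?addr0 // => k.
  rewrite -val_eqE /= => kl; case: ifP => // /negbT; rewrite -leqNgt => le_kl.
  by rewrite subn_eq0 leqNgt ltn_neqAle le_kl kl.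
rewrite PN // big1 // => k _; case: ifP => // _.
by rewrite subn_eq0 leqNgt (leq_trans (ltn_ord k)).
Qed.

(** Row a of the symmetrizer lists the coefficients of P / z^a, and the block
    column evaluates them at z^2. *)
Lemma symm0_mul_F0 P N : (forall l, (N <= l)%N -> coef_pmx P l = 0) ->
  cst_pmx (symm0 N P) *m F0 C q N = \mxcol_(a < N) sq_pmx (tail_pmx a P).
Proof.
move=> PN; have -> : cst_pmx (symm0 N P) =
    \mxblock_(i < N, j < N) cst_pmx (coef_pmx P (i + j)).
  by apply/matrixP => i j; rewrite !mxE.
rewrite mul_mxblock_mxrow; apply: eq_mxcol => a.
rewrite (@pmx_coefE (tail_pmx a P) N) => [|l Nl]; last first.
  by rewrite coef_tail_pmx PN // (leq_trans Nl) ?leq_addr.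
rewrite /sq_pmx map_mx_sum; apply: eq_bigr => b _.
rewrite mul_mx_scalar map_mxZ /= -/(sq_pmx _) sq_cst_pmx coef_tail_pmx addnC.
by rewrite comp_Xn_poly -exprM mul2n.
Qed.

Lemma star_F0 N : star_pmx (F0 C q N) = (F0 C q N)^T.
Proof.
apply/matrixP => i j; rewrite !mxE; case: eqP => _; rewrite ?mulr1n ?mulr0n.
  by rewrite map_polyXn.
by rewrite map_poly0.
Qed.

Lemma F0_mul_symm0 P N : (forall l, (N <= l)%N -> coef_pmx P l = 0) ->
  star_pmx (F0 C q N) *m cst_pmx (symm0 N P) =
  \mxrow_(a < N) sq_pmx (tail_pmx a P).
Proof.
move=> PN; apply: trmx_inj; rewrite trmx_mul star_F0 trmxK tr_mxrow.
have -> : (cst_pmx (symm0 N P))^T = cst_pmx (symm0 N P^T).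
  rewrite /cst_pmx map_trmx; congr map_mx; rewrite /symm0 tr_mxblock.
  apply: eq_mxblock => i j; rewrite addnC.
  by apply/matrixP => k l; rewrite !mxE.
rewrite symm0_mul_F0 => [|l Nl].
  by apply: eq_mxcol => a; apply/matrixP => i j; rewrite !mxE.
by apply/trmx_inj; rewrite trmx0 -(PN l Nl); apply/matrixP => i j; rewrite !mxE.
Qed.

(** The signs of both diagonal matrices combine to (-1)^(i + j), turning
    Markov parameters into Laurent coefficients. *)
Lemma signed_hankel N (t : nat -> 'M[C]_q) :
  Jtilde C q N *m (\mxblock_(i < N, j < N) t (i + j)%N) *m Jtilde C q N =
  \mxblock_(i < N, j < N) ((-1) ^+ (i + j) *: t (i + j)%N).
Proof.
rewrite /Jtilde mul_mxdiag_mxblock mul_mxblock_mxdiag.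
apply: eq_mxblock => i j; rewrite mul_scalar_mx mul_mx_scalar scalerA.
by rewrite -exprD addnC.
Qed.

Definition quad_form N (W : 'M[C]_(\sum_(i < N) q)) : 'M[C2]_q :=
  in_x (star_pmx (F0 C q N)) *m cst_pmx2 W *m in_y (F0 C q N).

Lemma quad_form_hankel P Q N (t : nat -> 'M[C]_q) :
    (forall l, (N <= l)%N -> coef_pmx P l = 0) ->
    (forall l, (N <= l)%N -> coef_pmx Q l = 0) ->
  quad_form (symm0 N P *m Jtilde C q N
               *m (\mxblock_(i < N, j < N) t (i + j)%N)
               *m Jtilde C q N *m symm0 N Q) =
  hankel_form N N (x_tail P) (fun k => cst_pmx2 ((-1) ^+ k *: t k)) (y_tail Q).
Proof.
move=> PN QN; rewrite -(mulmxA (symm0 N P)) -(mulmxA (symm0 N P)) signed_hankel.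
rewrite /quad_form !cst_pmx2M !mulmxA -(in_x_cst (symm0 N P)) -in_xM.
rewrite (F0_mul_symm0 PN) -mulmxA -in_yM (symm0_mul_F0 QN).
have -> : in_x (\mxrow_(a < N) sq_pmx (tail_pmx a P)) =
    \mxrow_(a < N) x_tail P a.
  by apply/matrixP => i j; rewrite !mxE.
have -> : in_y (\mxcol_(a < N) sq_pmx (tail_pmx a Q)) =
    \mxcol_(a < N) y_tail Q a.
  by apply/matrixP => i j; rewrite !mxE.
have -> : cst_pmx2 (\mxblock_(i < N, j < N) ((-1) ^+ (i + j) *: t (i + j)%N)) =
    \mxblock_(i < N, j < N) cst_pmx2 ((-1) ^+ (i + j) *: t (i + j)%N).
  by apply/matrixP => i j; rewrite !mxE.
rewrite mul_mxrow_mxblock mul_mxrow_mxcol /hankel_form exchange_big.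
by apply: eq_bigr => b _; rewrite mulmx_suml.
Qed.

Lemma F1E N : F1 C q N = 'X *: F0 C q N.
Proof. by apply/matrixP => i j; rewrite !mxE mulrnAr exprS. Qed.

Lemma star_pmxXZ a b (P : 'M[{poly C}]_(a, b)) :
  star_pmx ('X *: P) = 'X *: star_pmx P.
Proof. by apply/matrixP => i j; rewrite !mxE rmorphM /= map_polyX. Qed.

Lemma quad_form_block N N' (W0 : 'M[C]_(\sum_(i < N) q))
    (W1 : 'M[C]_(\sum_(i < N') q)) :
  let F := col_mx (F0 C q N) (F1 C q N') in
  in_x (star_pmx F) *m cst_pmx2 (block_mx W0 0 0 W1) *m in_y F =
  quad_form W0 + ('X * 'X%:P) *: quad_form W1.
Proof.
move=> F; have -> : in_x (star_pmx F) =
    row_mx (in_x (star_pmx (F0 C q N))) ('X *: in_x (star_pmx (F0 C q N'))).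
  by rewrite /star_pmx /F map_col_mx tr_col_mx /in_x map_row_mx F1E -in_xXZ
    -star_pmxXZ.
have -> : in_y F = col_mx (in_y (F0 C q N)) ('X%:P *: in_y (F0 C q N')).
  by rewrite {1}/in_y map_col_mx F1E -in_yXZ.
have -> : cst_pmx2 (block_mx W0 0 0 W1) =
    block_mx (cst_pmx2 W0) 0 0 (cst_pmx2 W1).
  by rewrite /cst_pmx2 /cst_pmx /in_y !map_block_mx !map_mx0.
rewrite mul_row_block mul_row_col !mulmx0 addr0 add0r /quad_form.
by rewrite -!scalemxAl -scalemxAr scalerA.
Qed.

Lemma pmx_parity P : P = sq_pmx (hpart P) + 'X *: sq_pmx (gpart P).
Proof.
apply/matrixP => i j; rewrite !mxE -[LHS](poly_even_odd (P i j)).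
by rewrite [X in _ + X]mulrC.
Qed.

Lemma neg_pmx_parity P : neg_pmx P = sq_pmx (hpart P) - 'X *: sq_pmx (gpart P).
Proof.
apply/matrixP => i j; rewrite !mxE -{1}(poly_even_odd (P i j)).
rewrite comp_polyD comp_polyM comp_polyX -!comp_polyA comp_Xn_poly sqrrN.
by rewrite mulrN [X in _ - X]mulrC.
Qed.

Lemma coef_hpart P l : coef_pmx (hpart P) l = coef_pmx P l.*2.
Proof. by apply/matrixP => i j; rewrite !mxE coef_even_poly. Qed.

Lemma coef_gpart P l : coef_pmx (gpart P) l = coef_pmx P l.*2.+1.
Proof. by apply/matrixP => i j; rewrite !mxE coef_odd_poly. Qed.

Lemma hpart_star P : hpart (star_pmx P) = star_pmx (hpart P).
Proof. by apply: coef_pmxP => l; rewrite !(coef_hpart, coef_star_pmx). Qed.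

Lemma gpart_star P : gpart (star_pmx P) = star_pmx (gpart P).
Proof. by apply: coef_pmxP => l; rewrite !(coef_gpart, coef_star_pmx). Qed.

Lemma star_neg_pmx P : star_pmx (neg_pmx P) = neg_pmx (star_pmx P).
Proof.
by apply/matrixP => i j; rewrite !mxE map_comp_poly rmorphN /= map_polyX.
Qed.

Lemma calF_eq n (A : nat -> 'M[C]_q) (P N : 'M[C2]_q) :
    let h := hpart (fpoly n A) in let g := gpart (fpoly n A) in
    'X ^+ 2 *: P + N = x_tail (star_pmx h) 0 *m y_tail g 0 ->
    'X%:P ^+ 2 *: P + N = x_tail (star_pmx g) 0 *m y_tail h 0 ->
  calF n A = 2%:R *: ratmx2 (N - ('X * 'X%:P) *: P).
Proof.
move=> h g; rewrite /x_tail /y_tail !tail_pmx0 => EX EY.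
have XY0 : tofrac ('X - 'X%:P : C2) != 0 by rewrite tofrac_eq0 polyXsubC_eq0.
rewrite /calF; set f := fpoly n A.
have in_xB (M M' : 'M[{poly C}]_q) : in_x (M - M') = in_x M - in_x M'.
  exact: map_mxB.
have in_yB (M M' : 'M[{poly C}]_q) : in_y (M - M') = in_y M - in_y M'.
  exact: map_mxB.
have in_xD (M M' : 'M[{poly C}]_q) : in_x (M + M') = in_x M + in_x M'.
  exact: map_mxD.
have in_yD (M M' : 'M[{poly C}]_q) : in_y (M + M') = in_y M + in_y M'.
  exact: map_mxD.
rewrite star_neg_pmx [in X in X *m _ - _](pmx_parity (star_pmx f)).
rewrite [in X in _ - _ *m X](pmx_parity f).
rewrite !neg_pmx_parity hpart_star gpart_star.
rewrite !in_xB !in_yB in_xD in_yD !in_xXZ !in_yXZ (parity_identity EX EY).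
rewrite /ratmx2 !map_mxZ /= !scalerA mulrA mulVf // mul1r.
by rewrite rmorph_nat.
Qed.

Lemma coef_fpoly n (A : nat -> 'M[C]_q) l :
  coef_pmx (fpoly n A) l = if (l <= n)%N then A (n - l)%N else 0.
Proof.
rewrite coef_pmx_sum; under eq_bigr => k _ do rewrite coef_pmxXnZ coef_cst_pmx.
case: leqP => [ln|nl].
  have kP : (n - l < n.+1)%N by rewrite ltnS leq_subr.
  rewrite (bigD1 (Ordinal kP)) //= subKn // ltnn subnn eqxx big1 ?addr0 // => k.
  rewrite -val_eqE /= => /eqP kl; case: ltnP => // nkl; case: eqP => // lnk.
  by case: kl; have := ltn_ord k; lia.
rewrite big1 // => k _; case: ltnP => // nkl; case: eqP => //.
by have := ltn_ord k; lia.
Qed.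

End Evaluation.

(** * Markov parameters and the two parity cases *)

Section MarkovRelations.
Variables (C : numClosedFieldType) (q : nat).
Implicit Types (M : 'M[ratfun C]_q) (p r : 'M[{poly C}]_q) (e : nat -> 'M[C]_q).

(** If v p = 0 with v of degree k, the coefficient of degree k + d is v_k times
    the invertible leading coefficient of p, so v_k = 0: v must vanish. *)
Lemma ratmx_unit p d :
    (forall i, (d < i)%N -> coef_pmx p i = 0) -> \det (coef_pmx p d) != 0 ->
  ratmx p \in unitmx.
Proof.
move=> pd lead; rewrite unitmxE unitfE /ratmx det_map_mx tofrac_eq0.
apply/negP => /det0P[v v0 vp]; move/eqP: v0; apply.
(* each step lowers a bound on the degree of v by killing its top coefficient *)
have v_coef k : (forall l, (k <= l)%N -> coef_pmx v l = 0) -> v = 0.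
  elim: k => [|k IH] vk.
    apply: coef_pmxP => l; rewrite vk //.
    by apply/matrixP => i j; rewrite !mxE coef0.
  apply: IH => l; rewrite leq_eqVlt => /predU1P[<-|/vk //].
  have vkA : coef_pmx v k *m coef_pmx p d = 0.
    apply/matrixP => i j; move/matrixP/(_ i j)/polyP/(_ (k + d)%N): vp.
    rewrite !mxE coef_sum coef0 => E; rewrite -[RHS]E; apply: eq_bigr => t _.
    have kP : (k < (k + d).+1)%N by rewrite ltnS leq_addr.
    rewrite coefM (bigD1 (Ordinal kP)) //= addKn big1 ?addr0 ?mxE // => u.
    rewrite -val_eqE /= => uk; case: (ltngtP u k) uk => // uk _.
      have /pd/matrixP/(_ t j) : (d < k + d - u)%N by lia.
      by rewrite !mxE => ->; rewrite mulr0.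
    by have /matrixP/(_ i t) := vk u uk; rewrite !mxE => ->; rewrite mul0r.
  have u : coef_pmx p d \in unitmx by rewrite unitmxE unitfE.
  by rewrite -[coef_pmx v k](mulmxK u) vkA mul0mx.
apply: (v_coef (\max_(j < q) size (v ord0 j))%N) => l vl.
apply/matrixP => i j; rewrite !mxE ord1; apply: nth_default.
by apply: leq_trans vl; exact: (@leq_bigmax _ (fun k => size (v ord0 k)) j).
Qed.

Lemma laurent_tr e M :
  laurent_at_infty e M -> laurent_at_infty (fun k => (e k)^T) M^T.
Proof.
move=> eM N i l; have := eM N l i; congr vanishes_at_infty; congr (_ * _).
rewrite !mxE !summxE; congr (_ - _); apply: eq_bigr => k _.
by rewrite !mxE.
Qed.

Section Relations.
Variables (e : nat -> 'M[C]_q) (M : 'M[ratfun C]_q) (p r : 'M[{poly C}]_q).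
Variable d : nat.
Hypothesis eM : laurent_at_infty e M.
Hypothesis p_deg : forall i, (d < i)%N -> coef_pmx p i = 0.
Hypothesis p_lead : \det (coef_pmx p d) != 0.
Hypothesis ME : M = ratmx r *m invmx (ratmx p).
Hypothesis MH : star_ratmx M = M.

Let Mp : M *m ratmx p = ratmx r.
Proof. by rewrite ME mulmxKV // (ratmx_unit p_deg). Qed.

(** Conjugating M p = r with M^* = M gives p^* M = r^*; transposed, this has
    the shape of the right-hand relation, so that the Laurent lemmas apply to
    M^T. *)
Let MTp : M^T *m ratmx (star_pmx p)^T = ratmx (star_pmx r)^T.
Proof.
have ratmx_tr (P : 'M[{poly C}]_q) : ratmx P^T = (ratmx P)^T.
  by rewrite /ratmx map_trmx.
rewrite (ratmx_tr (star_pmx p)) (ratmx_tr (star_pmx r)) -trmx_mul.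
congr trmx.
by rewrite -!star_ratmx_ratmx -{1}MH -star_ratmxM Mp.
Qed.

Let star_p_deg i : (d < i)%N -> coef_pmx (star_pmx p)^T i = 0.
Proof.
move=> /p_deg pi0; apply/matrixP => k l; move/matrixP/(_ k l): pi0.
by rewrite !mxE coef_map => /= ->; rewrite rmorph0.
Qed.

Lemma markov_right_quotient K : (d <= K)%N ->
  \sum_(b < K) cst_pmx2 (e b) *m y_tail p b.+1 = y_tail r 0.
Proof.
move=> dK; rewrite /y_tail tail_pmx0 -(laurent_quotient eM Mp p_deg dK).
rewrite sq_pmx_sum in_y_sum; apply: eq_bigr => b _.
by rewrite sq_pmxM sq_cst_pmx in_yM.
Qed.

Lemma markov_right_orthogonal k :
  \sum_(b < d.+1) cst_pmx2 (e (b + k)%N) *m cst_pmx2 (coef_pmx p b) = 0.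
Proof.
rewrite -[RHS]cst_pmx2_0 -(laurent_orthogonal k eM Mp p_deg) cst_pmx2_sum.
by apply: eq_bigr => b _; rewrite cst_pmx2M.
Qed.

Lemma markov_left_quotient K : (d <= K)%N ->
  \sum_(a < K) x_tail (star_pmx p) a.+1 *m cst_pmx2 (e a) =
  x_tail (star_pmx r) 0.
Proof.
move=> dK; have := laurent_quotient (laurent_tr eM) MTp star_p_deg dK.
move/(congr1 (fun P => in_x (sq_pmx P^T))).
rewrite trmxK /x_tail tail_pmx0 => <-.
rewrite linear_sum /= sq_pmx_sum in_x_sum; apply: eq_bigr => a _.
rewrite trmx_mul -in_x_cst -(sq_cst_pmx (e a)) sq_pmxM in_xM.
by congr (in_x (sq_pmx _) *m in_x (sq_pmx _));
  apply/matrixP => i j; rewrite !mxE.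
Qed.

Lemma markov_left_orthogonal k :
  \sum_(a < d.+1)
     cst_pmx2 (coef_pmx (star_pmx p) a) *m cst_pmx2 (e (a + k)%N) = 0.
Proof.
have := laurent_orthogonal k (laurent_tr eM) MTp star_p_deg.
move/(congr1 (fun P => cst_pmx2 P^T)).
rewrite trmx0 linear_sum /= cst_pmx2_0 cst_pmx2_sum => E; rewrite -[RHS]E.
apply: eq_bigr => b _; rewrite trmx_mul trmxK cst_pmx2M.
by congr (cst_pmx2 _ *m _); apply/matrixP => i j; rewrite !mxE.
Qed.

End Relations.
End MarkovRelations.

Section ParityCases.
Variables (C : numClosedFieldType) (q : nat).
Implicit Types (A s : nat -> 'M[C]_q).

Lemma signed_block_diag N N' (S0 H0 R0 : 'M[C]_(\sum_(i < N) q))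
    (S1 H1 R1 : 'M[C]_(\sum_(i < N') q)) :
  block_mx S0 0 0 S1 *m calJ C q N N' *m block_mx H0 0 0 H1 *m calJ C q N N'
    *m block_mx R0 0 0 R1 =
  block_mx (S0 *m Jtilde C q N *m H0 *m Jtilde C q N *m R0) 0 0
           (S1 *m Jtilde C q N' *m H1 *m Jtilde C q N' *m R1).
Proof. by rewrite /calJ !mulmx_block !(mulmx0, mul0mx, addr0, add0r). Qed.

(** Both kinds of symmetrizers thus come under [symm0_mul_F0]. *)
Lemma symm1_tail N (P : 'M[{poly C}]_q) : symm1 N P = symm0 N (tail_pmx 1 P).
Proof. by apply: eq_mxblock => i j; rewrite coef_tail_pmx addn1. Qed.

Lemma x_tail_tail1 (P : 'M[{poly C}]_q) k :
  x_tail (tail_pmx 1 P) k = x_tail P k.+1.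
Proof.
congr (in_x (sq_pmx _)); apply: coef_pmxP => l.
by rewrite !coef_tail_pmx addn1 addnS.
Qed.

Lemma y_tail_tail1 (P : 'M[{poly C}]_q) k :
  y_tail (tail_pmx 1 P) k = y_tail P k.+1.
Proof.
congr (in_y (sq_pmx _)); apply: coef_pmxP => l.
by rewrite !coef_tail_pmx addn1 addnS.
Qed.

Lemma scale_H1 N s (a : C) :
  a *: H1 s N = \mxblock_(i < N, j < N) (a *: s (i + j)%N).
Proof. by apply/matrixP => i j; rewrite !mxE. Qed.

Lemma scale_H2 N s (a : C) :
  a *: H2 s N = \mxblock_(i < N, j < N) (a *: s (i + j).+1).
Proof. by apply/matrixP => i j; rewrite !mxE. Qed.

Lemma cst_pmx2N (M : 'M[C]_q) : cst_pmx2 (- M) = - cst_pmx2 M.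
Proof. by apply/matrixP => i j; rewrite !mxE !rmorphN. Qed.

(** g~ is g without its constant term, divided by z.  Hence its symmetrizer
    yields the quotients of g from the first one on. *)
Lemma gtilde_tail m A : gtilde m A = tail_pmx 1 (gpart (fpoly m.*2.+1 A)).
Proof.
apply: coef_pmxP => l; rewrite coef_tail_pmx coef_gpart coef_fpoly coef_pmx_sum.
under eq_bigr => k _ do rewrite coef_pmxXnZ coef_cst_pmx.
case: leqP => lm; last first.
  have kP : (m - l.+1 < m)%N by lia.
  rewrite (bigD1 (Ordinal kP)) //= big1 ?addr0 => [|k].
    case: ltnP => [|_]; first by lia.
    by case: eqP => [_|]; [congr A | ]; lia.
  rewrite -val_eqE /= => /eqP kl; case: ltnP => // nkl; case: eqP => // lnk.
  by case: kl; have := ltn_ord k; lia.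
rewrite big1 // => k _; case: ltnP => // nkl; case: eqP => //.
by have := ltn_ord k; lia.
Qed.

(** Here p = h, P is the Hankel form of (e_k) and N is minus that of (e_(k+1)),
    both in the quotients of h from the first on; X P and - N differ by the
    row a = 0, Y P and - N by the column b = 0. *)
Lemma calF_even m A s : \det (A 0%N) != 0 -> HTM m.*2 A ->
    markov_params m.*2 A s ->
  let F := col_mx (F0 C q m) (F1 C q m) in
  calF m.*2 A = 2%:R *: ratmx2 (in_x (star_pmx F) *m cst_pmx2 (W_even m A s 1)
                                *m in_y F).
Proof.
move=> detA0 /star_assoc_ratfun MH eM F.
set h := hpart (fpoly m.*2 A); set g := gpart (fpoly m.*2 A).
pose e k := (-1) ^+ k *: s k; pose E k := cst_pmx2 (e k).
have eL : laurent_at_infty e (assoc_ratfun m.*2 A) := eM.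
have ME : assoc_ratfun m.*2 A = ratmx g *m invmx (ratmx h).
  by rewrite /assoc_ratfun odd_double.
have h_deg i : (m < i)%N -> coef_pmx h i = 0.
  by move=> mi; rewrite coef_hpart coef_fpoly leq_double leqNgt mi.
have h_lead : \det (coef_pmx h m) != 0.
  by rewrite coef_hpart coef_fpoly leqnn subnn.
have hs_deg i : (m < i)%N -> coef_pmx (star_pmx h) i = 0.
  by move=> mi; rewrite coef_star_pmx h_deg // trmx0 map_mx0.
have tl_deg i : (m <= i)%N -> coef_pmx (tail_pmx 1 h) i = 0.
  by move=> mi; rewrite coef_tail_pmx h_deg // addn1.
have tls_deg i : (m <= i)%N -> coef_pmx (tail_pmx 1 (star_pmx h)) i = 0.
  by move=> mi; rewrite coef_tail_pmx hs_deg // addn1.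
pose Q t := hankel_form m m (fun a => x_tail (star_pmx h) a.+1) t
                            (fun b => y_tail h b.+1).
rewrite (@calF_eq _ _ _ _ (Q E) (- Q (fun k => E k.+1))).
- congr (_ *: ratmx2 _).
  rewrite /F /W_even -/h signed_block_diag quad_form_block.
  rewrite scale_H1 /H2 !symm1_tail.
  rewrite (quad_form_hankel (fun k => s k.+1)) //.
  rewrite (quad_form_hankel (fun k => _ *: s k)) //.
  rewrite /Q -scalerN -!hankel_formN; congr (_ + _ *: _).
    apply: eq_hankel_form => k; rewrite ?x_tail_tail1 ?y_tail_tail1 //.
    by rewrite /E /e -cst_pmx2N exprS mulN1r scaleNr opprK.
  apply: eq_hankel_form => k; rewrite ?x_tail_tail1 ?y_tail_tail1 //.
  by rewrite /E /e -cst_pmx2N expr1 scaleN1r scalerN.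
- rewrite /Q (hankel_form_shiftl m _ (x_tail_recl (star_pmx h))).
  + rewrite hankel_form_recl addrK; congr (_ *m _).
    exact (markov_right_quotient eL h_deg h_lead ME (leqnn m)).
  + by rewrite x_tail_eq0.
  + by move=> k; exact (markov_left_orthogonal eL h_deg h_lead ME MH k).
- rewrite /Q (hankel_form_shiftr m _ (y_tail_recl h)).
  + rewrite hankel_form_recr addrK; congr (_ *m _).
    exact (markov_left_quotient eL h_deg h_lead ME MH (leqnn m)).
  + by rewrite y_tail_eq0.
  + by move=> k; exact (markov_right_orthogonal eL h_deg h_lead ME k).
Qed.

(** Here p = z g, whose first quotient is g itself: N is the Hankel form of
    (e_k) in all quotients of g, and P is minus the form of (e_(k+1)) in the
    quotients from the first on.  X P cancels all of N but the column b = 0,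
    Y P all but the row a = 0. *)
Lemma calF_odd m A s : \det (A 0%N) != 0 -> HTM m.*2.+1 A ->
    markov_params m.*2.+1 A s ->
  let F := col_mx (F0 C q m.+1) (F1 C q m) in
  calF m.*2.+1 A = 2%:R *: ratmx2 (in_x (star_pmx F) *m cst_pmx2 (W_odd m A s 1)
                                *m in_y F).
Proof.
move=> detA0 /star_assoc_ratfun MH eM F.
set h := hpart (fpoly m.*2.+1 A); set g := gpart (fpoly m.*2.+1 A).
pose e k := (-1) ^+ k *: s k; pose E k := cst_pmx2 (e k).
have eL : laurent_at_infty e (assoc_ratfun m.*2.+1 A) := eM.
have ME : assoc_ratfun m.*2.+1 A = ratmx h *m invmx (ratmx ('X *: g)).
  by rewrite /assoc_ratfun /= odd_double.
have g_deg i : (m < i)%N -> coef_pmx g i = 0.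
  by move=> mi; rewrite coef_gpart coef_fpoly ltnS leq_double leqNgt mi.
have gs_deg i : (m < i)%N -> coef_pmx (star_pmx g) i = 0.
  by move=> mi; rewrite coef_star_pmx g_deg // trmx0 map_mx0.
have tl_deg i : (m <= i)%N -> coef_pmx (tail_pmx 1 g) i = 0.
  by move=> mi; rewrite coef_tail_pmx g_deg // addn1.
have tls_deg i : (m <= i)%N -> coef_pmx (tail_pmx 1 (star_pmx g)) i = 0.
  by move=> mi; rewrite coef_tail_pmx gs_deg // addn1.
have zg_deg i : (m.+1 < i)%N -> coef_pmx ('X *: g) i = 0.
  by case: i => // i mi; rewrite coef_pmxXZ g_deg.
have zg_lead : \det (coef_pmx ('X *: g) m.+1) != 0.
  by rewrite coef_pmxXZ coef_gpart coef_fpoly leqnn subnn.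
have tail_zg (P : 'M[{poly C}]_q) b : tail_pmx b.+1 ('X *: P) = tail_pmx b P.
  by apply: coef_pmxP => l; rewrite !coef_tail_pmx addnS coef_pmxXZ.
pose Q := hankel_form m m (fun a => x_tail (star_pmx g) a.+1)
            (fun k => E k.+1) (fun b => y_tail g b.+1).
pose N := hankel_form m.+1 m.+1 (x_tail (star_pmx g)) E (y_tail g).
rewrite (@calF_eq _ _ _ _ (- Q) N).
- congr (_ *: ratmx2 _).
  rewrite /F /W_odd -/g signed_block_diag quad_form_block.
  rewrite scale_H2 /H1 gtilde_tail -/g -tail_star_pmx.
  rewrite (quad_form_hankel s) // (quad_form_hankel (fun k => _ *: s k.+1)) //.
  rewrite scalerN opprK; congr (_ + _ *: _).
  apply: eq_hankel_form => k; rewrite ?x_tail_tail1 ?y_tail_tail1 //.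
  by rewrite /E /e expr1 scaleN1r scalerN exprS mulN1r scaleNr.
- rewrite scalerN /Q (hankel_form_shiftl m _ (x_tail_recl (star_pmx g))).
  + rewrite /N hankel_form_recr addrC addrK.
    have := markov_left_quotient eL zg_deg zg_lead ME MH (leqnn m.+1).
    rewrite star_pmxXZ => <-; congr (_ *m _); apply: eq_bigr => a _.
    by rewrite /x_tail tail_zg.
  + by rewrite x_tail_eq0.
  + move=> k; have := markov_left_orthogonal eL zg_deg zg_lead ME MH k.
    (* z g has no constant term, so orthogonality at k is that of g at k + 1 *)
    rewrite star_pmxXZ big_ord_recl coef_pmxXZ cst_pmx2_0 mul0mx add0r => E0.
    rewrite -[RHS]E0; apply: eq_bigr => a _.
    by rewrite lift0 coef_pmxXZ addSn.
- rewrite scalerN /Q (hankel_form_shiftr m _ (y_tail_recl g)).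
  + rewrite /N hankel_form_recl addrC addrK.
    have := markov_right_quotient eL zg_deg zg_lead ME (leqnn m.+1).
    move=> <-; congr (_ *m _); apply: eq_bigr => a _.
    by rewrite /y_tail tail_zg.
  + by rewrite y_tail_eq0.
  + move=> k; have := markov_right_orthogonal eL zg_deg zg_lead ME k.
    rewrite big_ord_recl coef_pmxXZ cst_pmx2_0 mulmx0 add0r => E0.
    rewrite -[RHS]E0; apply: eq_bigr => a _.
    by rewrite lift0 coef_pmxXZ addSn.
Qed.

End ParityCases.

Theorem corollary3p7 (R : realType) (q n : nat) (A s : nat -> 'M[R[i]]_q)
    (q_gt0 : (0 < q)%N) (n_gt0 : (0 < n)%N)
    (detA0 : \det (A 0%N) != 0)
    (htm : HTM n A)
    (markov : markov_params n A s) :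
  (forall m : nat, (1 <= m)%N -> n = m.*2 ->
     let F := col_mx (F0 R[i] q m) (F1 R[i] q m) in
     calF n A =
       2%:R *: ratmx2 (in_x (star_pmx F) *m cst_pmx2 (W_even m A s 1)
                       *m in_y F))
  /\
  (forall m : nat, (1 <= m)%N -> n = m.*2.+1 ->
     let F := col_mx (F0 R[i] q m.+1) (F1 R[i] q m) in
     calF n A =
       2%:R *: ratmx2 (in_x (star_pmx F) *m cst_pmx2 (W_odd m A s 1)
                       *m in_y F)).
Proof.
by split=> m _ n_eq; subst n; [apply: calF_even | apply: calF_odd].
Qed.
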